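(* Let $\mathbb{F}$ be a field of characteristic zero and let $\mathfrak{sl}_2$ be the Lie algebra of traceless $2\times 2$ matrices over $\mathbb{F}$. Then the group $\mathrm{LAut}(\mathfrak{sl}_2)$ of local automorphisms of $\mathfrak{sl}_2$ coincides with the group $\mathrm{Aut}^{\pm}(\mathfrak{sl}_2)$ of all automorphisms and anti-automorphisms of $\mathfrak{sl}_2$.
   Context: The Lie bracket on $\mathfrak{sl}_2$ is the commutator $[a,b]=ab-ba$. For a Lie algebra $\mathfrak{g}$ over $\mathbb{F}$, a linear bijective map $\varphi:\mathfrak{g}\to\mathfrak{g}$ is an automorphism (resp. an anti-automorphism) if $\varphi([x,y])=[\varphi(x),\varphi(y)]$ (resp. $\varphi([x,y])=[\varphi(y),\varphi(x)]$) for all $x,y\in\mathfrak{g}$. $\mathrm{Aut}(\mathfrak{g})$ is the group of automorphisms, $\mathrm{Aut}^{-}(\mathfrak{g})$ the set of anti-automorphisms, and $\mathrm{Aut}^{\pm}(\mathfrak{g})=\mathrm{Aut}(\mathfrak{g})\cup\mathrm{Aut}^{-}(\mathfrak{g})$, a group under composition (the signed automorphism group). A linear map $\Delta:\mathfrak{g}\to\mathfrak{g}$ is a local automorphism if for every $X\in\mathfrak{g}$ there exists an automorphism $\varphi_X$ of $\mathfrak{g}$ (depending on $X$) with $\Delta(X)=\varphi_X(X)$. $\mathrm{LAut}(\mathfrak{g})$ is the set of all local automorphisms of $\mathfrak{g}$, with composition as operation. *)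

(* Defs.v *)
From HB Require Import structures.
From mathcomp Require Import all_boot all_order all_algebra ring.

Set Implicit Arguments.
Unset Strict Implicit.
Unset Printing Implicit Defensive.

Import GRing.Theory.
Local Open Scope ring_scope.

HB.mixin Record Lmodule_isLieAlgebra (F : fieldType) V of GRing.Lmodule F V := {
  lie : V -> V -> V;
  lie_linearl : forall z : V, linear (fun x : V => lie x z);
  lie_linearr : forall x : V, linear (fun z : V => lie x z);
  (* lie x x = 0 rather than antisymmetry: stronger in characteristic 2 *)
  liexx : forall x, lie x x = 0;
  lie_jacobi : forall x y z,
    lie x (lie y z) + lie y (lie z x) + lie z (lie x y) = 0
}.

#[short(type="lieAlgType")]
HB.structure Definition LieAlgebra (F : fieldType) :=
  { V of GRing.Lmodule F V & Lmodule_isLieAlgebra F V }.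

Section LieMaps.
Variables (F : fieldType) (g : lieAlgType F).
Implicit Types f : g -> g.

Definition lie_aut f : Prop :=
  [/\ linear f, bijective f & forall x y, f (lie x y) = lie (f x) (f y)].

Definition lie_antiaut f : Prop :=
  [/\ linear f, bijective f & forall x y, f (lie x y) = lie (f y) (f x)].

Definition signed_aut f : Prop := lie_aut f \/ lie_antiaut f.

Definition local_aut f : Prop :=
  linear f /\ forall x, exists phi, lie_aut phi /\ f x = phi x.

End LieMaps.

(* S is a group under composition of self-maps of T; the inverse in S is a
   two-sided inverse map. *)
Definition comp_group (T : Type) (S : (T -> T) -> Prop) : Prop :=
  [/\ S id,
      forall f h, S f -> S h -> S (f \o h)
    & forall f, S f -> exists h, [/\ S h, cancel f h & cancel h f]].

Section SL2.
Variable F : fieldType.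

Definition traceless : {pred 'M[F]_2} := fun A => \tr A == 0.

Fact traceless_submod : submod_closed traceless.
Proof.
split=> [|a A B /eqP trA /eqP trB]; first by rewrite unfold_in mxtrace0.
by rewrite unfold_in mxtraceD mxtraceZ trA trB mulr0 addr0.
Qed.

HB.instance Definition _ :=
  GRing.isSubmodClosed.Build F 'M[F]_2 traceless traceless_submod.

Record sl2 : predArgType :=
  Sl2 { sl2_val : 'M[F]_2; sl2_valP : sl2_val \in traceless }.

HB.instance Definition _ := [isSub for sl2_val].
HB.instance Definition _ := [Choice of sl2 by <:].
HB.instance Definition _ := [SubChoice_isSubLmodule of sl2 by <:].

Fact commutator_traceless (A B : 'M[F]_2) : A *m B - B *m A \in traceless.
Proof. by rewrite unfold_in raddfB /= mxtrace_mulC subrr. Qed.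

Definition sl2_lie (X Y : sl2) : sl2 :=
  Sl2 (commutator_traceless (sl2_val X) (sl2_val Y)).

Fact sl2_lie_linearl Z : linear (fun X => sl2_lie X Z).
Proof.
move=> a X Y; apply: val_inj => /=.
rewrite !mulmxDl !mulmxDr -!scalemxAl -!scalemxAr scalerBr opprD.
by rewrite addrACA.
Qed.

Fact sl2_lie_linearr X : linear (fun Z => sl2_lie X Z).
Proof.
move=> a Y Z; apply: val_inj => /=.
rewrite !mulmxDl !mulmxDr -!scalemxAl -!scalemxAr scalerBr opprD.
by rewrite addrACA.
Qed.

Fact sl2_liexx X : sl2_lie X X = 0.
Proof. by apply: val_inj; rewrite /= subrr. Qed.

Fact sl2_jacobi X Y Z :
  sl2_lie X (sl2_lie Y Z) + sl2_lie Y (sl2_lie Z X) + sl2_lie Z (sl2_lie X Y)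
    = 0.
Proof.
apply: val_inj => /=; move: (sl2_val X) (sl2_val Y) (sl2_val Z) => A B C.
rewrite !mulmxBl !mulmxBr !mulmxA !opprB.
set t1 := A *m B *m C; set t2 := A *m C *m B; set t3 := B *m C *m A.
set t4 := C *m B *m A; set t5 := B *m A *m C; set t6 := C *m A *m B.
apply/matrixP => i j; rewrite !mxE.
by move: (t1 i j) (t2 i j) (t3 i j) (t4 i j) (t5 i j) (t6 i j) => *; ring.
Qed.

HB.instance Definition _ := Lmodule_isLieAlgebra.Build F sl2
  sl2_lie_linearl sl2_lie_linearr sl2_liexx sl2_jacobi.

End SL2.

(* Main.v *)
Require Import Defs.
From mathcomp Require Import all_boot all_order all_algebra.
From mathcomp Require Import ring.
Local Open Scope ring_scope.

Set Implicit Arguments.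
Unset Strict Implicit.
Unset Printing Implicit Defensive.

Import GRing.Theory.

(** On sl2 the trace form B(X, Y) = tr(XY) is a nondegenerate symmetric
    bilinear form of rank 3 for which the Lie bracket is a cross product:
    T(X, Y, Z) = B([X, Y], Z) is an alternating trilinear form, that is, a
    volume form.  So the structure maps of sl2 can be read off from B and an
    orientation, and the theorem says that local automorphisms are exactly the
    isometries of B.

    A local automorphism D is signed.  Automorphisms preserve B(X, X), because
    (ad X)^3 = 2 B(X, X) ad X makes this scalar an invariant of the bracket
    ([ad_cubed], [lie_aut_trform]).  Preservation of B(X, X) is tested one
    vector at a time, so it passes to local automorphisms, and by polarization
    a linear D that preserves it preserves B ([local_aut_trform]).  Since
    T(X1, X2, X3) T(Y1, Y2, Y3) is -2 times the Gram determinant of the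
    B(Xi, Yj) ([vol_gram]), an isometry multiplies T by a constant sign
    ([trform_isometry_vol]): this sign is det D, obtained without determinants
    of endomorphisms.  Nondegeneracy of B turns this into
    [D X, D Y] = +- D [X, Y], and the sign decides between automorphism and
    anti-automorphism ([local_aut_signed]).

    A signed automorphism is local.  If D is an anti-automorphism then - D is
    an automorphism and D X = (- D)(- X), so it is enough to find, for each X,
    an automorphism that maps X to - X.  The half-turn around an anisotropic
    axis orthogonal to X does so ([half_turn_aut], [signed_aut_local]).

    The signed automorphisms of any Lie algebra form a group
    ([comp_group_signed_aut]); hence so do the local automorphisms of sl2. *)

(** * Signed automorphisms of a Lie algebra *)

Section SignedGroup.
Variables (F : fieldType) (g : lieAlgType F).
Implicit Types (f h : g -> g) (x y : g).

Lemma linear_fun0 f : linear f -> f 0 = 0.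
Proof.
by move=> lf; have := lf (-1) 0 0; rewrite scaler0 addr0 scaleN1r addNr.
Qed.

Lemma linear_funD f : linear f -> {morph f : x y / x + y}.
Proof. by move=> lf x y; have := lf 1 x y; rewrite !scale1r. Qed.

Lemma linear_funZ f a : linear f -> {morph f : x / a *: x}.
Proof. by move=> lf x; have := lf a x 0; rewrite (linear_fun0 lf) !addr0. Qed.

Lemma linear_funN f : linear f -> {morph f : x / - x}.
Proof. by move=> lf x; rewrite -scaleN1r (linear_funZ _ lf) scaleN1r. Qed.

Lemma lieDl x y z : lie (x + y) z = lie x z + lie y z :> g.
Proof. by have := lie_linearl z 1 x y; rewrite /= !scale1r. Qed.

Lemma lieDr x y z : lie x (y + z) = lie x y + lie x z :> g.
Proof. by have := lie_linearr x 1 y z; rewrite /= !scale1r. Qed.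

Lemma lieNC x y : lie y x = - lie x y :> g.
Proof.
have := liexx (x + y); rewrite lieDl !lieDr !liexx addr0 add0r.
by move/eqP; rewrite addrC addr_eq0 => /eqP.
Qed.

Lemma lieNN x y : lie (- x) (- y) = lie x y :> g.
Proof.
rewrite (linear_funN (lie_linearl (- y)) x) /=.
by rewrite (linear_funN (lie_linearr x) y) opprK.
Qed.

Lemma linear_comp f h : linear f -> linear h -> linear (f \o h).
Proof. by move=> lf lh a x y /=; rewrite lh lf. Qed.

Lemma linear_inv f h : linear f -> cancel f h -> cancel h f -> linear h.
Proof. by move=> lf fK hK a x y; apply: (can_inj fK); rewrite lf !hK. Qed.

Lemma lie_aut_comp f h : lie_aut f -> lie_aut h -> lie_aut (f \o h).
Proof.
move=> [lf bf mf] [lh bh mh]; split=> [||x y /=]; last by rewrite mh mf.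
  exact: linear_comp.
exact: bij_comp.
Qed.

(** Negation is itself an anti-automorphism, which reduces anti-automorphisms
    to automorphisms. *)
Lemma lie_antiaut_opp f : lie_antiaut f -> lie_aut (fun x => - f x).
Proof.
move=> [lf [k fK kK] mf]; split=> [a x y||x y].
- by rewrite lf opprD scalerN.
- by exists (fun x => k (- x)) => x; rewrite ?opprK ?fK ?kK ?opprK.
- by rewrite mf lieNC opprK lieNN.
Qed.

(** The two kinds compose like signs, and an inverse map is of the same kind as
    the map it inverts. *)
Lemma comp_group_signed_aut : comp_group (fun f => signed_aut f).
Proof.
split.
- by left; split=> //; exists id.
- move=> f h Sf Sh.
  have [lf bf] : linear f /\ bijective f by case: Sf => -[].
  have [lh bh] : linear h /\ bijective h by case: Sh => -[].
  have lfh := linear_comp lf lh; have bfh := bij_comp bf bh.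
  by case: Sf Sh => -[_ _ mf] [] [_ _ mh]; [left|right|right|left];
     split=> // x y /=; rewrite mh mf.
- move=> f Sf.
  have [lf [h fK hK]] : linear f /\ bijective f by case: Sf => -[].
  exists h; split=> //.
  have lh := linear_inv lf fK hK.
  have bh : bijective h by exists f.
  by case: Sf => -[_ _ mf]; [left|right];
     split=> // x y; apply: (can_inj fK); rewrite mf !hK.
Qed.

End SignedGroup.

(** * Coordinates on sl2 *)

Section TraceForm.
Variable F : fieldType.
Implicit Types (X Y Z : sl2 F) (a b c : F).

Definition coordh X := sl2_val X 0 0.
Definition coorde X := sl2_val X 0 1.
Definition coordf X := sl2_val X 1 0.

Lemma sum_ord2 (t : 'I_2 -> F) : \sum_i t i = t 0 + t 1.
Proof. by rewrite big_ord_recl big_ord1; congr (_ + t _); apply: val_inj. Qed.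

Lemma sl2_val11 X : sl2_val X 1 1 = - coordh X.
Proof.
have /eqP := sl2_valP X; rewrite /mxtrace sum_ord2.
by move/eqP; rewrite addrC addr_eq0 => /eqP.
Qed.

Lemma ord2P (P : 'I_2 -> Prop) : P 0 -> P 1 -> forall i, P i.
Proof.
by move=> P0 P1 [[|[|//]] i]; [move: P0|move: P1]; congr P; apply: val_inj.
Qed.

Lemma sl2_eq X Y : coordh X = coordh Y -> coorde X = coorde Y ->
  coordf X = coordf Y -> X = Y.
Proof.
move=> hh he hf; apply/val_inj/matrixP.
apply: ord2P; apply: ord2P => //.
by rewrite !sl2_val11 hh.
Qed.

Definition sl2_mx a b c : 'M[F]_2 :=
  \matrix_(i, j) if i == 0 then (if j == 0 then a else b)
                 else if j == 0 then c else - a.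

Fact sl2_mx_traceless a b c : sl2_mx a b c \in @traceless F.
Proof. by rewrite unfold_in /mxtrace sum_ord2 !mxE /= subrr. Qed.

Definition sl2_of a b c : sl2 F := Sl2 (sl2_mx_traceless a b c).

Lemma coord_sl2_of a b c :
  (coordh (sl2_of a b c) = a) * (coorde (sl2_of a b c) = b) *
  (coordf (sl2_of a b c) = c).
Proof. by rewrite /coordh /coorde /coordf !mxE. Qed.

Lemma coord0 : (coordh 0 = 0) * (coorde 0 = 0) * (coordf 0 = 0).
Proof. by rewrite /coordh /coorde /coordf !mxE. Qed.

Lemma coordD X Y : (coordh (X + Y) = coordh X + coordh Y) *
  (coorde (X + Y) = coorde X + coorde Y) *
  (coordf (X + Y) = coordf X + coordf Y).
Proof. by rewrite /coordh /coorde /coordf !mxE. Qed.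

Lemma coordN X : (coordh (- X) = - coordh X) *
  (coorde (- X) = - coorde X) * (coordf (- X) = - coordf X).
Proof. by rewrite /coordh /coorde /coordf !mxE. Qed.

Lemma coordZ a X : (coordh (a *: X) = a * coordh X) *
  (coorde (a *: X) = a * coorde X) * (coordf (a *: X) = a * coordf X).
Proof. by rewrite /coordh /coorde /coordf !mxE. Qed.

Lemma mul2mxE (A B : 'M[F]_2) i j :
  (A *m B) i j = A i 0 * B 0 j + A i 1 * B 1 j.
Proof. by rewrite mxE sum_ord2. Qed.

Lemma coord_lie X Y :
  (coordh (lie X Y) = coorde X * coordf Y - coordf X * coorde Y) *
  (coorde (lie X Y) = 2 * (coordh X * coorde Y - coorde X * coordh Y)) *
  (coordf (lie X Y) = 2 * (coordf X * coordh Y - coordh X * coordf Y)).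
Proof.
rewrite /coordh /coorde /coordf /= !(mul2mxE, mxE).
by rewrite !sl2_val11 /coordh; split; [split|]; ring.
Qed.

Definition coordE := (coord0, coordD, coordN, coordZ, coord_sl2_of, coord_lie).

(** * The trace form, the volume form and half-turns *)

Definition trform X Y : F := \tr (sl2_val X *m sl2_val Y).

Lemma trformE X Y : trform X Y =
  2 * coordh X * coordh Y + coorde X * coordf Y + coordf X * coorde Y.
Proof.
rewrite /trform /mxtrace sum_ord2.
rewrite !mul2mxE !sl2_val11 -/(coordh X) -/(coordh Y).
rewrite -/(coorde X) -/(coorde Y) -/(coordf X) -/(coordf Y); ring.
Qed.

Definition vol X Y Z : F := trform (lie X Y) Z.

(** The eigenvalues of ad X are 0 and the two square roots of 2 B(X, X), so
    this is Cayley-Hamilton for ad X.  It expresses B(X, X) through the bracket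
    alone. *)
Lemma ad_cubed X Y :
  lie X (lie X (lie X Y)) = (2 * trform X X) *: lie X Y.
Proof. by apply: sl2_eq; rewrite trformE !coordE; ring. Qed.

(** The product of two determinants is the determinant of the product: [vol] is
    a multiple of the coordinate determinant, and - 2 is the ratio between
    T(h, e, f)^2 = 4 and the Gram determinant of (h, e, f), which is - 2. *)
Lemma vol_gram X1 X2 X3 Y1 Y2 Y3 :
  vol X1 X2 X3 * vol Y1 Y2 Y3 = - 2 *
   (trform X1 Y1 * (trform X2 Y2 * trform X3 Y3 - trform X2 Y3 * trform X3 Y2)
  - trform X1 Y2 * (trform X2 Y1 * trform X3 Y3 - trform X2 Y3 * trform X3 Y1)
  + trform X1 Y3 * (trform X2 Y1 * trform X3 Y2 - trform X2 Y2 * trform X3 Y1)).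
Proof. by rewrite /vol !trformE !coordE; ring. Qed.

(** Cramer's rule, in a division-free form: the alternating combination of
    four vectors in dimension 3 vanishes. *)
Lemma vol_cramer X Y Z W :
  vol X Y Z *: W = vol W Y Z *: X + vol X W Z *: Y + vol X Y W *: Z.
Proof. by apply: sl2_eq; rewrite /vol !trformE !coordE; ring. Qed.

(** The rotation by a half-turn around the line of Y, that is, the opposite of
    the reflection in the plane orthogonal to Y; for anisotropic Y it is also
    the conjugation by the invertible matrix Y. *)
Definition half_turn Y Z : sl2 F := (2 * trform Y Z / trform Y Y) *: Y - Z.

Lemma half_turn_aut Y : trform Y Y != 0 -> lie_aut (half_turn Y).
Proof.
move=> nY; split.
- move=> a Z W; apply: sl2_eq; rewrite /half_turn !coordE;
  move: nY; rewrite !trformE !coordE => nY; field; exact: nY.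
- by exists (half_turn Y) => Z; apply: sl2_eq; rewrite /half_turn !coordE;
  move: nY; rewrite !trformE !coordE => nY; field; exact: nY.
- move=> Z W; apply: sl2_eq; rewrite /half_turn !coordE;
  move: nY; rewrite !trformE !coordE => nY; field; exact: nY.
Qed.

Lemma half_turn_orth Y X : trform Y X = 0 -> half_turn Y X = - X.
Proof. by rewrite /half_turn => ->; rewrite mulr0 mul0r scale0r add0r. Qed.

Hypothesis two_neq0 : 2 != 0 :> F.

(** The plane orthogonal to X is never totally isotropic, because B is
    nondegenerate of rank 3. *)
Lemma exists_anisotropic_orth X : exists Y, trform Y X = 0 /\ trform Y Y != 0.
Proof.
(* The upper triangular Y have B(Y, Y) = 2 a ^ 2, a being the coordinate along
   h, and so do the lower triangular ones; one family contains a suitable Y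
   unless X is diagonal, and then any antidiagonal Y is orthogonal to X. *)
have [b0|b0] := eqVneq (coorde X) 0; last first.
  exists (sl2_of (coorde X) 0 (- 2 * coordh X)); rewrite !trformE !coordE.
  split; first by ring.
  by rewrite mul0r mulr0 !addr0 !mulf_neq0.
have [c0|c0] := eqVneq (coordf X) 0; last first.
  exists (sl2_of (coordf X) (- 2 * coordh X) 0); rewrite !trformE !coordE.
  split; first by ring.
  by rewrite mul0r mulr0 !addr0 !mulf_neq0.
exists (sl2_of 0 1 1); rewrite !trformE !coordE b0 c0; split; first by ring.
by rewrite !mulr0 !mulr1 add0r.
Qed.

Lemma trform_nondeg X Y : (forall Z, trform X Z = trform Y Z) -> X = Y.
Proof.
move=> eqXY; apply: sl2_eq.
- have := eqXY (sl2_of 1 0 0); rewrite !trformE !coordE !mulr0 !addr0 !mulr1.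
  exact: mulfI.
- have := eqXY (sl2_of 0 0 1); rewrite !trformE !coordE.
  by rewrite !mulr0 !addr0 !add0r !mulr1.
- have := eqXY (sl2_of 0 1 0); rewrite !trformE !coordE.
  by rewrite !mulr0 !add0r !mulr1.
Qed.

(** * Isometries of the trace form *)

Lemma sl2_center X : (forall Y, lie X Y = 0) -> X = 0.
Proof.
move=> X0; apply: sl2_eq; rewrite coord0.
- have /(congr1 coorde) := X0 (sl2_of 0 1 0); rewrite !coordE.
  rewrite mulr1 mulr0 subr0 => /eqP.
  by rewrite mulf_eq0 (negPf two_neq0) => /eqP.
- have /(congr1 coordh) := X0 (sl2_of 0 0 1); rewrite !coordE.
  by rewrite mulr1 mulr0 subr0.
- have /(congr1 coordh) := X0 (sl2_of 0 1 0); rewrite !coordE.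
  by rewrite mulr1 mulr0 sub0r => /eqP; rewrite oppr_eq0 => /eqP.
Qed.

(** Comparing [ad_cubed] at f X with the image of [ad_cubed] at X gives
    2 (B(f X, f X) - B(X, X)) f [X, Y] = 0 for all Y, and only X = 0 is
    central. *)
Lemma lie_aut_trform (f : sl2 F -> sl2 F) X :
  lie_aut f -> trform (f X) (f X) = trform X X.
Proof.
move=> [lf bf mf]; apply/eqP/negPn/negP => neq.
suff X0 : X = 0 by move: neq; rewrite X0 (linear_fun0 lf) eqxx.
apply: sl2_center => Y; apply: (bij_inj bf); rewrite (linear_fun0 lf).
have := ad_cubed (f X) (f Y); rewrite -!mf ad_cubed (linear_funZ _ lf).
move/eqP; rewrite -subr_eq0 -scalerBl scaler_eq0 -mulrBr mulf_eq0.
by rewrite (negPf two_neq0) subr_eq0 eq_sym (negPf neq) => /eqP.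
Qed.

Lemma trform_polar X Y :
  2 * trform X Y = trform (X + Y) (X + Y) - trform X X - trform Y Y.
Proof. by rewrite !trformE !coordE; ring. Qed.

Lemma local_aut_trform (f : sl2 F -> sl2 F) X Y :
  local_aut f -> trform (f X) (f Y) = trform X Y.
Proof.
move=> [lf locf]; apply: (mulfI two_neq0); rewrite !trform_polar.
have fq Z : trform (f Z) (f Z) = trform Z Z.
  by have [phi [aphi ->]] := locf Z; apply: lie_aut_trform.
by rewrite -(linear_funD lf) !fq.
Qed.

Let h := sl2_of 1 0 0.
Let e := sl2_of 0 1 0.
Let f := sl2_of 0 0 1.

Lemma vol_std : vol h e f = 2.
Proof. by rewrite /vol trformE !coordE; ring. Qed.

(** The square of the volume of an image basis is a Gram determinant, hence is
    preserved; the sign it leaves open on (h, e, f) is then forced on all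
    triples by applying [vol_gram] to (X, Y, Z) and (h, e, f). *)
Lemma trform_isometry_vol (D : sl2 F -> sl2 F) :
  (forall X Y, trform (D X) (D Y) = trform X Y) ->
  exists s : bool, forall X Y Z, vol (D X) (D Y) (D Z) = (-1) ^+ s * vol X Y Z.
Proof.
move=> iD.
have volM X1 X2 X3 Y1 Y2 Y3 :
    vol (D X1) (D X2) (D X3) * vol (D Y1) (D Y2) (D Y3)
    = vol X1 X2 X3 * vol Y1 Y2 Y3 by rewrite !vol_gram !iD.
have sq : vol (D h) (D e) (D f) ^+ 2 = 2 ^+ 2 by rewrite expr2 volM vol_std.
have [s Ds] : exists s : bool, vol (D h) (D e) (D f) = (-1) ^+ s * 2.
  move/eqP: sq; rewrite eqf_sqr => /orP[] /eqP ->.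
    by exists false; rewrite mul1r.
  by exists true; rewrite mulN1r.
exists s => X Y Z; apply: (mulIf two_neq0).
have := volM X Y Z h e f; rewrite Ds vol_std.
move/(congr1 ( *%R ((-1) ^+ s))).
by rewrite mulrCA [_ ^+ s * (_ ^+ s * _)]mulrA -signr_addb addbb mul1r mulrA.
Qed.

(** The images of h, e, f have nonzero volume, so [vol_cramer] writes every
    vector in terms of them: this is the inverse map. *)
Lemma trform_isometry_bij (D : sl2 F -> sl2 F) : linear D ->
  (forall X Y, trform (D X) (D Y) = trform X Y) -> bijective D.
Proof.
move=> lD iD; have [s vD] := trform_isometry_vol iD.
have injD : injective D.
  by move=> X Y eqD; apply: trform_nondeg => Z; rewrite -iD eqD iD.
have v0 : vol (D h) (D e) (D f) != 0.
  by rewrite vD vol_std mulf_neq0 // signr_eq0.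
set v := vol _ _ _ in v0.
pose E W := v^-1 *: (vol W (D e) (D f) *: h + vol (D h) W (D f) *: e
                     + vol (D h) (D e) W *: f).
have EK : cancel E D.
  move=> W; rewrite (linear_funZ _ lD) !(linear_funD lD) !(linear_funZ _ lD).
  by rewrite -vol_cramer scalerA mulVf // scale1r.
by exists E => // X; apply: injD; rewrite EK.
Qed.

(** B([D X, D Y], D Z) = +- B([X, Y], Z) = +- B(D [X, Y], D Z), and every
    vector is some D Z, so nondegeneracy removes the last argument. *)
Lemma local_aut_signed (D : sl2 F -> sl2 F) : local_aut D -> signed_aut D.
Proof.
move=> locD; have iD X Y := local_aut_trform X Y locD.
have lD : linear D by case: locD.
have bD := trform_isometry_bij lD iD; have [D' DK D'K] := bD.
have [s vD] := trform_isometry_vol iD.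
have liesD X Y : lie (D X) (D Y) = (-1) ^+ s *: D (lie X Y).
  apply: trform_nondeg => Z; rewrite -[Z]D'K -/(vol _ _ _) vD.
  rewrite /vol -iD trformE [RHS]trformE !coordZ; ring.
case: s {vD} liesD => liesD; [right|left]; split=> // X Y.
  by rewrite liesD scaleN1r lieNC (linear_funN lD).
by rewrite liesD scale1r.
Qed.

Lemma signed_aut_local (D : sl2 F -> sl2 F) : signed_aut D -> local_aut D.
Proof.
case=> aD; first by split=> [|X]; [case: aD | exists D].
split=> [|X]; first by case: aD.
have [Y [XY0 nY]] := exists_anisotropic_orth X.
exists ((fun Z => - D Z) \o half_turn Y); split.
  exact: (lie_aut_comp (lie_antiaut_opp aD) (half_turn_aut nY)).
have lD : linear D by case: aD.
by rewrite /= half_turn_orth // (linear_funN lD) opprK.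
Qed.

End TraceForm.

Theorem theorem2p4 (F : fieldType) (char0 : [pchar F] =i pred0) :
  [/\ comp_group (fun Delta : sl2 F -> sl2 F => local_aut Delta),
      comp_group (fun Delta : sl2 F -> sl2 F => signed_aut Delta)
    & forall Delta : sl2 F -> sl2 F, local_aut Delta <-> signed_aut Delta].
Proof.
have two_neq0 : 2 != 0 :> F by move/pcharf0P: char0 => ->.
have localE (D : sl2 F -> sl2 F) : local_aut D <-> signed_aut D.
  by split; [apply: local_aut_signed | apply: signed_aut_local].
have signedG := comp_group_signed_aut (sl2 F).
split=> //; case: signedG => S1 SM SV; split.
- exact/localE.
- by move=> f h /localE Sf /localE Sh; apply/localE/SM.
- by move=> f /localE/SV[h [Sh fK hK]]; exists h; split=> //; apply/localE.
Qed.
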